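(* Let $1\le r<n$ be integers, and let $\mu\subset(n-r)^r$ be a partition with $|\mu|=(r-1)(n-r-1)$. Then the integer $\Gamma^\mu_{r,n}$ is equal to the number of $1$-strip-less semi-standard Young tableaux of shape $\mu$ filled with entries $1,2,\ldots,r$.
   Context: Partitions have non-increasing parts; $(n-r)^r$ is the rectangle with $r$ rows and $n-r$ columns, and $\mu\subset(n-r)^r$ means the Young diagram of $\mu$ (left- and upward-justified, larger parts on top) fits inside it. A semi-standard Young tableau (SSYT) has entries weakly increasing across rows and strictly increasing down columns. The integer $\Gamma^\mu_{r,n}$ is $$\Gamma^\mu_{r,n}=\sum_{j=0}^{m(\mu)}(-1)^j\binom{n}{j}\,|\mathrm{SSYT}_{r-j}(\mu^j)|,$$ where $m(\mu)$ is the number of parts of $\mu$ equal to $n-r$, $\mu^j$ is the partition of length $r-j$ (zero parts allowed) obtained from $\mu=(\mu_1,\ldots,\mu_r)$ by removing $j$ parts equal to $n-r$, and $|\mathrm{SSYT}_{r'}(\mu')|$ is the number of SSYTs of shape $\mu'$ with entries in $\{1,\ldots,r'\}$. (By a theorem of Klyachko, $\Gamma^\mu_{r,n}$ is the coefficient of the Schubert class $\sigma_\mu$ in the class of a generic torus orbit closure in $\mathrm{Gr}(r,n)$.) A strip of $\mu$ is a set of exactly $n-r$ boxes of the Young diagram of $\mu$ such that no two boxes lie in the same column, and whenever a box $b_1$ of the set lies in a column to the left of a box $b_2$ of the set, $b_1$ does not lie in a row above $b_2$. For a SSYT of shape $\mu$ with entries in $\{1,\ldots,r\}$ and $i\in\{1,\ldots,r-1\}$,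 an $(i,i+1)$-strip is a strip all of whose boxes are filled with $i$ or $i+1$ and in which all instances of $i$ appear to the left of all instances of $i+1$ (a strip all of whose boxes contain $i$, or all of whose boxes contain $i+1$, is allowed). A $1$-strip is an $(i,i+1)$-strip for some $i\in\{1,\ldots,r-1\}$. A SSYT is $1$-strip-less if it contains no $1$-strip. *)

(* Defs.v *)
From HB Require Import structures.
From mathcomp Require Import all_boot all_order all_algebra.

Set Implicit Arguments.
Unset Strict Implicit.
Unset Printing Implicit Defensive.

Local Open Scope nat_scope.

Definition partition_in_rect (r w : nat) (mu : seq nat) : bool :=
  [&& size mu == r, sorted geq mu & all (fun p => p <= w) mu].

(* Young diagram of [mu] in matrix coordinates: rows are numbered from the top,
   columns from the left, both from 0. *)
Definition box (mu : seq nat) : finType :=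
  {i : 'I_(size mu) & 'I_(nth 0 mu i)}.

Definition row (mu : seq nat) (b : box mu) : nat := tag b.
Definition col (mu : seq nat) (b : box mu) : nat := tagged b.

(* ['I_k] stands for the alphabet {1, ..., k}, the ordinal [x] being the letter
   [x.+1]. *)
Definition filling (k : nat) (mu : seq nat) : finType := {ffun box mu -> 'I_k}.

Definition entry (k : nat) (mu : seq nat) (t : filling k mu) (b : box mu) : nat :=
  (t b).+1.

Definition semistandard (k : nat) (mu : seq nat) (t : filling k mu) : bool :=
  [forall b1, forall b2,
     ((row b1 == row b2) && (col b1 < col b2) ==> (entry t b1 <= entry t b2)) &&
     ((col b1 == col b2) && (row b1 < row b2) ==> (entry t b1 < entry t b2))].

Definition SSYT (k : nat) (mu : seq nat) : {set filling k mu} :=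
  [set t | semistandard t].

Definition remove_parts (w j : nat) (mu : seq nat) : seq nat :=
  iter j (rem w) mu.

Definition Gamma (r n : nat) (mu : seq nat) : int :=
  (\sum_(0 <= j < (count_mem (n - r)%N mu).+1)
     (-1) ^+ j * 'C(n, j)%:Z * #|SSYT (r - j)%N (remove_parts (n - r)%N j mu)|%:Z)%R.

Definition strip (w : nat) (mu : seq nat) (S : {set box mu}) : bool :=
  [&& #|S| == w,
      [forall b1 in S, forall b2 in S, (b1 != b2) ==> (col b1 != col b2)] &
      [forall b1 in S, forall b2 in S,
         (col b1 < col b2) ==> ~~ (row b1 < row b2)]].

Definition ii1_strip (w k : nat) (mu : seq nat) (t : filling k mu) (i : nat)
    (S : {set box mu}) : bool :=
  [&& strip w S,
      [forall b in S, (entry t b == i) || (entry t b == i.+1)] &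
      [forall b1 in S, forall b2 in S,
         (entry t b1 == i) && (entry t b2 == i.+1) ==> (col b1 < col b2)]].

(* The bounds [0 < i] and [i < k] make [i] range over {1, ..., k - 1}. *)
Definition one_strip (w k : nat) (mu : seq nat) (t : filling k mu)
    (S : {set box mu}) : bool :=
  [exists i : 'I_k, (0 < i) && ii1_strip w t i S].

Definition one_strip_less (w k : nat) (mu : seq nat) (t : filling k mu) : bool :=
  ~~ [exists S : {set box mu}, one_strip w t S].

(* Main.v *)
Require Import Defs.
From mathcomp Require Import all_boot all_order all_algebra.
From mathcomp Require Import zify ring.

(** Write [w = n - r].  A filling of a diagram inside [w] columns with letters
    [0, ..., k - 1] is read as a binary word of length [k * w]: the letters are
    taken in increasing order and, for each letter, the columns from the last
    one to the first one; the bit says whether the column contains the letter.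
    This reading identifies semistandard tableaux of a given shape with the
    words such that

    - at each letter boundary, the columns have received weakly more letters
      from right to left ([interlaced]: the entries up to a letter form a
      Young diagram), and
    - each column finally receives as many letters as it has boxes
      ([column_totals]);

    see [word_inj], [word_surj] and [card_SSYT_words].

    The order of reading is chosen so that a strip whose first columns contain
    [i] and whose last columns contain [i + 1] is exactly a block of [w]
    consecutive ones: such a block meets each column once.  So a tableau has no
    strip iff its word has no run of [w] ones ([one_strip_less_word]).

    Since [|mu| = (r - 1)(w - 1)], a word of a tableau of shape [mu] has
    [r w - |mu| = n - 1] zeros, hence [n] (possibly empty) maximal runs of ones.
    Removing [w] consecutive ones from a run shifts the rest of the word by a
    full period, so it keeps every later bit in its column, and lowers all the
    column totals by one.  The two conditions above are stable under this
    operation and under its inverse ([interlaced_insert],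
    [admissible_insert]).  Consequently the words in which [j] chosen runs have
    length at least [w] are as many as the tableaux with [r - j] letters whose
    shape is [mu] with [j] full rows removed, and inclusion-exclusion on the
    set of the runs of length at least [w] gives the alternating sum, with its
    binomial coefficient ['C(n, j)].

    The inclusion-exclusion treats one run at a time: with [f g j] the number
    of words at level [j] (that is, after [j] removals) whose first [g] runs
    are shorter than [w], one has [f g j = f g.+1 j + f g j.+1]
    ([words_admissibleS]), which unrolls to the binomial sum
    ([binomial_unroll]). *)

Set Implicit Arguments.
Unset Strict Implicit.
Unset Printing Implicit Defensive.

Import Defs GRing.Theory.
Local Open Scope nat_scope.

(** * Interlaced words and insertion of a full period of ones *)

(** With [q = i * w + d], this is the number of letters below [i] in the column
    that is read at position [d] of each period. *)
Definition ones_before (w : nat) (u : seq bool) (q : nat) : nat :=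
  \sum_(k < q %/ w) nth false u (k * w + q %% w).

(** Unless [w %| q.+1], the positions [q] and [q.+1] stand for the same letter
    and two adjacent columns.  Indexed by positions instead of pairs of a letter
    and a column, the condition is invariant under shifts by [w], even when a
    word is cut in the middle of a period. *)
Definition interlaced (w : nat) (u : seq bool) : bool :=
  all (fun q => (w %| q.+1) || (ones_before w u q <= ones_before w u q.+1))
      (iota 0 (size u + w)).

Lemma interlacedP w u :
  reflect (forall q, q < size u + w -> ~~ (w %| q.+1) ->
             ones_before w u q <= ones_before w u q.+1)
          (interlaced w u).
Proof.
apply: (iffP allP) => [h q hq /negbTE nd | h q].
  by have := h q; rewrite mem_iota nd; apply.
by rewrite mem_iota => hq; case: (boolP (w %| q.+1)) => //= /h; apply.
Qed.

Lemma step_ind w (P : nat -> Prop) :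
    0 < w -> (forall q, q < w -> P q) -> (forall q, P q -> P (q + w)) ->
  forall q, P q.
Proof.
move=> w0 P0 PS; elim/ltn_ind => q IH; case: (ltnP q w) => [/P0 // | le_wq].
by rewrite -(subnK le_wq); apply/PS/IH; rewrite ltn_subrL w0 (leq_trans w0).
Qed.

Lemma ones_before_small w u q : q < w -> ones_before w u q = 0.
Proof. by move=> hq; rewrite /ones_before divn_small ?big_ord0. Qed.

Lemma ones_before_step w u q :
  0 < w -> ones_before w u (q + w) = ones_before w u q + nth false u q.
Proof.
move=> w0; rewrite /ones_before modnDr divnDr // divnn w0 addn1 big_ord_recr /=.
by rewrite -divn_eq.
Qed.

Lemma ones_before_prefix w x y z q : 0 < w -> q < size x + w ->
  ones_before w (x ++ y) q = ones_before w (x ++ z) q.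
Proof.
move=> w0; move: q; apply: (step_ind w0) => [q hq _ | q IH].
  by rewrite !ones_before_small.
rewrite ltn_add2r => hq; rewrite !ones_before_step // !nth_cat hq IH //.
exact: ltn_addr.
Qed.

(** A block of [w] consecutive ones meets every residue class modulo [w] once,
    whatever its starting point. *)
Lemma ones_before_insert w x y q : 0 < w -> size x <= q ->
  ones_before w (x ++ nseq w true ++ y) (q + w) = (ones_before w (x ++ y) q).+1.
Proof.
move=> w0.
have near p : size x <= p < size x + w ->
    ones_before w (x ++ nseq w true ++ y) (p + w) =
    (ones_before w (x ++ y) p).+1.
  case/andP=> lo hi; rewrite ones_before_step //.
  rewrite (@ones_before_prefix w x (nseq w true ++ y) y) //.
  rewrite !nth_cat ltnNge lo /= size_nseq nth_nseq.
  have -> : p - size x < w by lia.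
  exact: addn1.
move: q; apply: (step_ind w0).
  by move=> q hq lo; apply: near; lia.
move=> q IH lo.
have [hq|hq] := ltnP (q + w) (size x + w); first by apply: near; lia.
rewrite ones_before_step // IH ?ones_before_step //; last by lia.
rewrite !nth_cat size_nseq; have -> : q + w < size x = false by lia.
have -> : q + w - size x < w = false by lia.
have -> : q < size x = false by lia.
have -> : q + w - size x - w = q - size x by lia.
exact: addSn.
Qed.

(** Both conditions compare the same counts, possibly all increased by one,
    except for the pair of positions with [q.+1 = size x + w]: there the bit at
    the end of [x] may add one letter to the right column, but the block has
    already added one to the left column. *)
Lemma interlaced_insert w x y : 0 < w ->
  interlaced w (x ++ nseq w true ++ y) = interlaced w (x ++ y).
Proof.
move=> w0; have sz : size (x ++ nseq w true ++ y) = size (x ++ y) + w.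
  by rewrite !size_cat size_nseq; lia.
have szx : size x <= size (x ++ y) by rewrite size_cat leq_addr.
apply/interlacedP/interlacedP; rewrite sz => h q hq nd.
- have [lt_qx | le_xq] := ltnP q (size x).
    rewrite -!(ones_before_prefix (nseq w true ++ y) y) //; try lia.
    by apply: h => //; lia.
  rewrite -ltnS -!ones_before_insert //; last by lia.
  by apply: h; [lia | rewrite -addSn dvdn_addl].
- have [lt_qx | le_xq] := ltnP q.+1 (size x + w).
    rewrite !(ones_before_prefix (nseq w true ++ y) y) //; try lia.
    by apply: h => //; lia.
  have [lt_qw | le_wq] := ltnP q w; first by rewrite ones_before_small.
  have hS : ones_before w (x ++ y) (q - w) <= ones_before w (x ++ y) (q - w).+1.
    by apply: h; [lia | rewrite -(dvdn_addl (q - w).+1 (dvdnn w)) addSn subnK].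
  rewrite -(subnK le_wq) -addSn.
  rewrite (@ones_before_insert w x y (q - w).+1) //; last by lia.
  have [lt | le] := ltnP (q - w) (size x); last first.
    by rewrite ones_before_insert.
  rewrite (ones_before_prefix _ y) //; last by lia.
  rewrite ones_before_step //; apply: (leq_trans _ (n := _.+1)); last exact: hS.
  by rewrite -addn1 leq_add2l; case: nth.
Qed.

(** * Runs of ones in a word *)

(** The runs are numbered from 0, each one but the first starting just after a
    zero; they may be empty. *)
Fixpoint gap_start (g : nat) (u : seq bool) : nat :=
  if g is g'.+1
  then (index false u).+1 + gap_start g' (drop (index false u).+1 u) else 0.

Fixpoint short_runs (w g : nat) (u : seq bool) : bool :=
  if g is g'.+1
  then (index false u < w) && short_runs w g' (drop (index false u).+1 u)
  else true.

Lemma count_negb_nseq i : count negb (nseq i true) = 0.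
Proof. by rewrite count_nseq. Qed.

Lemma index_false_run i z : index false (nseq i true ++ false :: z) = i.
Proof. by elim: i => //= i ->. Qed.

Lemma drop_run i z : drop i.+1 (nseq i true ++ false :: z) = z.
Proof. by elim: i => [|i] //=; rewrite drop0. Qed.

Lemma first_run u : 0 < count negb u ->
  exists i z, u = nseq i true ++ false :: z.
Proof.
elim: u => //= -[] u IH /=; last by exists 0, u.
by rewrite add0n => /IH [i [z ->]]; exists i.+1, z.
Qed.

Lemma full_run_prefix w v : w <= index false v -> v = nseq w true ++ drop w v.
Proof.
elim: w v => [|w IH] [|b v] //=.
by case: b => //= lt_wv; rewrite -IH.
Qed.

Lemma index_false_full_run w z : w <= index false (nseq w true ++ z).
Proof. by elim: w => //= w. Qed.

Lemma short_runsS w g u :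
  short_runs w g.+1 u =
  short_runs w g u && (index false (drop (gap_start g u) u) < w).
Proof.
elim: g u => [|g IH] u; first by rewrite /= drop0 andbT.
by rewrite [LHS]/= -/(short_runs w g.+1 _) IH /= drop_drop addnC andbA.
Qed.

Lemma gap_start_le g u : g <= count negb u -> gap_start g u <= size u.
Proof.
elim: g u => //= g IH u hg; have [|i [z def_u]] := @first_run u; first by lia.
move: hg; rewrite def_u count_cat count_negb_nseq /= add0n ltnS => /IH.
by rewrite index_false_run drop_run size_cat size_nseq /=; lia.
Qed.

(** The first [g] runs and the start of the next one only depend on the word up
    to that start, so they survive a change of the run number [g]. *)
Lemma gap_prefix w g u v : g <= count negb u ->
  let x := take (gap_start g u) u in
  [/\ count negb x = g, gap_start g (x ++ v) = gap_start g u
    & short_runs w g (x ++ v) = short_runs w g u].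
Proof.
elim: g u => [|g IH] u hg /=; first by rewrite take0.
have [|i [z def_u]] := @first_run u; first by lia.
move: hg; rewrite def_u count_cat count_negb_nseq /= add0n ltnS.
case/IH=> cz sz rz.
rewrite index_false_run drop_run -[nseq i true ++ _]/(nseq i true ++ _).
have -> : take (i.+1 + gap_start g z) (nseq i true ++ false :: z) =
          nseq i true ++ false :: take (gap_start g z) z.
  rewrite take_cat size_nseq; have -> : i.+1 + gap_start g z < i = false by lia.
  by have -> : i.+1 + gap_start g z - i = (gap_start g z).+1 by lia.
rewrite count_cat count_negb_nseq /= cz -catA /= index_false_run drop_run sz.
by rewrite rz.
Qed.

(** Since the default bit is [false], such a block lies inside the word. *)
Definition has_run (w : nat) (u : seq bool) : Prop :=
  exists s, forall p, p < w -> nth false u (s + p).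

Lemma short_runs_no_run w u : 0 < w ->
  short_runs w (count negb u).+1 u <-> ~ has_run w u.
Proof.
move=> w0; have [m] := ubnP (size u); elim: m u => // m IH u lt_um.
have [z0 | zpos] := posnP (count negb u).
  rewrite z0 /= andbT; have def_u : u = nseq (size u) true.
    by elim: u z0 {lt_um} => //= -[] u IHu //= /IHu {1}->.
  rewrite def_u; set k := size u.
  have -> : index false (nseq k true) = k by elim: (k) => //= k' ->.
  split=> [lt_kw [s hs] | no_run].
    by have := hs w.-1; rewrite nth_nseq; case: ifP => //; lia.
  rewrite ltnNge; apply/negP => le_wk; apply: no_run; exists 0 => p lt_pw.
  by rewrite nth_nseq add0n (leq_trans lt_pw).
have [i [z def_u]] := first_run zpos.
have lt_zm : size z < m by move: lt_um; rewrite def_u size_cat /=; lia.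
have -> : count negb u = (count negb z).+1.
  by rewrite def_u count_cat count_negb_nseq.
move: (IH z lt_zm); set c := (count negb z).+1 => IHz.
rewrite /= def_u index_false_run drop_run.
have nthi : nth false (nseq i true ++ false :: z) i = false.
  by rewrite nth_cat size_nseq ltnn subnn.
have nthr p : nth false (nseq i true ++ false :: z) (i.+1 + p) = nth false z p.
  rewrite nth_cat size_nseq; have -> : i.+1 + p < i = false by lia.
  by have -> : i.+1 + p - i = p.+1 by lia.
have nthl p : p < i -> nth false (nseq i true ++ false :: z) p.
  by move=> lt_pi; rewrite nth_cat size_nseq lt_pi nth_nseq lt_pi.
split=> [/andP[lt_iw /IHz no_run] [s hs] | no_run].
  have [le_si | lt_is] := leqP s i.
    have lt : i - s < w by lia.
    by have := hs _ lt; rewrite subnKC // nthi.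
  apply: no_run; exists (s - i.+1) => p /hs.
  have -> : s + p = i.+1 + (s - i.+1 + p) by lia.
  by rewrite nthr.
apply/andP; split; last first.
  apply/IHz => -[s hs]; apply: no_run; exists (i.+1 + s) => p /hs.
  by rewrite -addnA nthr.
rewrite ltnNge; apply/negP => le_wi; apply: no_run; exists 0 => p lt_pw.
by rewrite nthl // (leq_trans _ le_wi).
Qed.

(** * Counting words by their number of short runs *)

Definition words (m : nat) (P : pred (seq bool)) : nat :=
  #|[set u : m.-tuple bool | P u]|.

Lemma eq_words m (P P' : pred (seq bool)) :
  (forall u, size u = m -> P u = P' u) -> words m P = words m P'.
Proof. by move=> e; apply: eq_card => u; rewrite !inE e ?size_tuple. Qed.

Lemma words_split m (P Q : pred (seq bool)) :
  words m P = words m (predI P Q) + words m (predI P (predC Q)).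
Proof.
rewrite /words -(cardsID [set u : m.-tuple bool | Q u]).
by congr (_ + _); apply: eq_card => u; rewrite !inE //= andbC.
Qed.

Lemma words_eq0 m (P : pred (seq bool)) :
  (forall u, size u = m -> ~~ P u) -> words m P = 0.
Proof.
by move=> no; apply: eq_card0 => u; rewrite inE (negbTE (no _ _)) ?size_tuple.
Qed.

Lemma leq_words m m' (P P' : pred (seq bool)) f f' :
    (forall u, size u = m -> P u ->
       [/\ size (f u) = m', P' (f u) & f' (f u) = u]) ->
  words m P <= words m' P'.
Proof.
move=> hf; pose F (t : m.-tuple bool) := insubd (nseq_tuple m' false) (f t).
have valF (t : m.-tuple bool) : P t -> val (F t) = f t.
  move=> Pt; rewrite val_insubd.
  by case: (hf t (size_tuple t) Pt) => sz _ _; rewrite sz eqxx.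
rewrite /words -(card_in_imset (f := F)).
  apply/subset_leq_card/subsetP => _ /imsetP[u + ->]; rewrite inE => Pu.
  by rewrite inE valF //; have [] := hf u (size_tuple u) Pu.
move=> u v; rewrite !inE => Pu Pv /(congr1 val) eF; apply: val_inj.
have [_ _ eu] := hf u (size_tuple u) Pu.
have [_ _ ev] := hf v (size_tuple v) Pv.
by apply: etrans (esym eu) (etrans _ ev); rewrite -!valF ?eF.
Qed.

(** When [w] divides [size u], the count at [size u + d] runs over the whole
    word, for the column [w.-1 - d].  The offset [j] stands for the ones removed
    from this column. *)
Definition column_totals (w j : nat) (h : nat -> nat) (u : seq bool) : bool :=
  all (fun d => ones_before w u (size u + d) + j == h (w.-1 - d)) (iota 0 w).

(** The words of the tableaux that are left after [j] removals, with [z] zeros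
    and with first [g] runs shorter than [w]. *)
Definition admissible (w j : nat) (h : nat -> nat) (z g : nat) :
    pred (seq bool) :=
  fun u => [&& interlaced w u, column_totals w j h u, count negb u == z
             & short_runs w g u].

Definition insert_run (w g : nat) (u : seq bool) : seq bool :=
  take (gap_start g u) u ++ nseq w true ++ drop (gap_start g u) u.

Definition remove_run (w g : nat) (u : seq bool) : seq bool :=
  take (gap_start g u) u ++ drop (gap_start g u + w) u.

Lemma gap_start_insert w g u :
  g <= count negb u -> gap_start g (insert_run w g u) = gap_start g u.
Proof. by case/(gap_prefix w (nseq w true ++ drop (gap_start g u) u)). Qed.

Lemma insert_runK w g u : g <= count negb u ->
  remove_run w g (insert_run w g u) = u.
Proof.
move=> hg; have szx := size_takel (gap_start_le hg).
rewrite /remove_run gap_start_insert // /insert_run take_size_cat //.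
rewrite catA drop_size_cat ?cat_take_drop //.
by rewrite size_cat size_nseq szx.
Qed.

Lemma remove_runK w g u : g <= count negb u ->
    w <= index false (drop (gap_start g u) u) ->
  insert_run w g (remove_run w g u) = u.
Proof.
move=> hg full; have szx := size_takel (gap_start_le hg).
have [_ sr _] := gap_prefix w (drop (gap_start g u + w) u) hg.
rewrite /insert_run {}sr /remove_run take_size_cat // drop_size_cat //.
by rewrite addnC -drop_drop -full_run_prefix // cat_take_drop.
Qed.

Lemma admissible_insert w j h z g u : 0 < w -> g <= count negb u ->
  admissible w j h z g (insert_run w g u) = admissible w j.+1 h z g u.
Proof.
move=> w0 hg; rewrite /admissible.
have [_ _ ->] := gap_prefix w (nseq w true ++ drop (gap_start g u) u) hg.
rewrite interlaced_insert // cat_take_drop; congr [&& _, _, _ & _].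
  have sz : size (insert_run w g u) = size u + w.
    by rewrite !size_cat size_nseq addnCA -size_cat cat_take_drop addnC.
  apply: eq_all => d; rewrite sz addnAC ones_before_insert ?cat_take_drop //.
    by rewrite addSnnS.
  by rewrite size_take_min; lia.
by rewrite !count_cat count_negb_nseq add0n -count_cat cat_take_drop.
Qed.

(** Among the words whose first [g] runs are short, those whose run number [g]
    has length at least [w] lose [w] ones of this run, and nothing else is
    affected.  For [j >= r] both sides vanish, the empty word having no zero. *)
Lemma words_admissibleS w r j h z g : 0 < w -> 0 < z -> g <= z ->
  words ((r - j) * w) (admissible w j h z g) =
  words ((r - j) * w) (admissible w j h z g.+1) +
  words ((r - j.+1) * w) (admissible w j.+1 h z g).
Proof.
move=> w0 z0 le_gz.
rewrite (words_split _ _ (fun u => index false (drop (gap_start g u) u) < w)).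
congr (_ + _).
  by apply: eq_words => u _; rewrite /= /admissible short_runsS !andbA.
have zeros i u : admissible w i h z g u -> count negb u = z.
  by case/and4P=> _ _ /eqP.
have [le_rj | lt_jr] := leqP r j.
  have [-> ->] : (r - j) * w = 0 /\ (r - j.+1) * w = 0 by split; nia.
  rewrite !words_eq0 // => u sz; apply/negP => /=.
    by move/zeros; move/size0nil: sz => -> /=; lia.
  by move/andP=> [/zeros]; move/size0nil: sz => -> /=; lia.
have em : (r - j) * w = (r - j.+1) * w + w by nia.
apply/eqP; rewrite eqn_leq; apply/andP; split.
- apply: (leq_words (f := remove_run w g) (f' := insert_run w g)) => u sz /=.
  rewrite -leqNgt => /andP[adm full]; have cz := zeros _ _ adm.
  have hg : g <= count negb u by rewrite cz.
  have rK := remove_runK hg full.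
  have cz' : count negb (remove_run w g u) = z.
    have [cx _ _] := gap_prefix w (drop (gap_start g u + w) u) hg.
    rewrite -cz -[in RHS]rK !count_cat count_negb_nseq add0n -!count_cat.
    by rewrite cat_take_drop.
  split=> //; last by rewrite -(@admissible_insert w) ?rK // cz'.
  have : size u = size (remove_run w g u) + w.
    rewrite -[in LHS]rK !size_cat size_nseq addnCA -size_cat cat_take_drop.
    by rewrite addnC /remove_run size_cat.
  lia.
- apply: (leq_words (f := insert_run w g) (f' := remove_run w g)) => u sz adm.
  have hg : g <= count negb u by rewrite (zeros _ _ adm).
  split; last exact: insert_runK.
    by rewrite !size_cat size_nseq addnCA -size_cat cat_take_drop; lia.
  rewrite /= admissible_insert // adm -leqNgt gap_start_insert //.
  rewrite /insert_run drop_size_cat ?index_false_full_run //.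
  exact: size_takel (gap_start_le hg).
Qed.

(** The recurrence reads [f g.+1 j = f g j - f g j.+1]: the function [f n] is
    the [n]-th power of (identity minus shift) applied to [f 0]. *)
Lemma binomial_unroll (n : nat) (f : nat -> nat -> nat) :
    (forall g j, g < n -> f g j = f g.+1 j + f g j.+1) ->
  forall j, ((f n j)%:Z =
    \sum_(i < n.+1) (-1) ^+ i * 'C(n, i)%:Z * (f 0 (j + i)%N)%:Z)%R.
Proof.
elim: n => [|n IH] hf j.
  by rewrite big_ord1 /= addn0 !mul1r.
have {}IH := IH (fun g j hg => hf g j (ltnW hg)).
have -> : ((f n.+1 j)%:Z = (f n j)%:Z - (f n j.+1)%:Z)%R.
  by rewrite (hf n j (ltnSn n)) PoszD addrK.
rewrite !IH.
have -> : (\sum_(i < n.+1) (-1) ^+ i * 'C(n, i)%:Z * (f 0 (j + i)%N)%:Z =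
           \sum_(i < n.+2) (-1) ^+ i * 'C(n, i)%:Z * (f 0 (j + i)%N)%:Z)%R.
  by rewrite [RHS]big_ord_recr /= bin_small // mulr0 mul0r addr0.
rewrite big_ord_recl [RHS]big_ord_recl !bin0 -addrA; congr (_ + _)%R.
rewrite -sumrB; apply: eq_bigr => i _ /=.
rewrite binS PoszD addSnnS exprS; ring.
Qed.

(** * Semistandard tableaux as words *)

(** In a list on which [P] holds for an initial segment, the length of this
    segment is the number of elements that satisfy [P].  Two uses: the rows
    that reach a column, and the entries of a column below a letter. *)
Lemma count_prefix (T : Type) (P : pred T) (x0 : T) (s : seq T) (x : nat) :
    sorted (fun a b => P b ==> P a) s -> x < size s ->
  P (nth x0 s x) = (x < count P s).
Proof.
elim: s x => //= a s IH x sorted_s lt_xs.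
have [Pa | nPa] := boolP (P a).
  by case: x lt_xs => [|x] /= lt_xs; rewrite ?Pa ?IH ?(path_sorted sorted_s).
have tr : transitive (fun a b => P b ==> P a).
  by move=> y z v /implyP yz /implyP vy; apply/implyP => /vy /yz.
have allN : all (predC P) s.
  apply: sub_all (order_path_min tr sorted_s) => b /=.
  by rewrite (negbTE nPa) implybF.
have -> : count P s = 0.
  by apply/eqP; rewrite -leqn0 leqNgt -has_count -all_predC.
case: x lt_xs => [|x] /= lt_xs; first by rewrite (negbTE nPa).
exact/negbTE/(all_nthP x0 allN).
Qed.

Lemma sum_mem_count (s : seq nat) i :
  uniq s -> \sum_(j < i) ((j : nat) \in s : nat) = count (fun y => y < i) s.
Proof.
move=> us; elim: i => [|i IH]; first by rewrite big_ord0 count_pred0.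
rewrite big_ord_recr /= IH -count_uniq_mem //.
by elim: s {us IH} => //= a s <-; rewrite ltnS; lia.
Qed.

Definition column_height (nu : seq nat) (c : nat) : nat :=
  count (fun p => c < p) nu.

Lemma column_height_row nu x c : sorted geq nu ->
  (c < nth 0 nu x) = (x < column_height nu c).
Proof.
move=> sorted_nu; have [lt_x | le_x] := ltnP x (size nu).
  apply: (@count_prefix _ (fun p => c < p)) => //.
  apply: sub_sorted sorted_nu => a b /= le_ba.
  by apply/implyP => /leq_trans; apply.
rewrite nth_default //; apply/esym/negbTE; rewrite -leqNgt.
exact: leq_trans (count_size _ _) le_x.
Qed.

Lemma row_lt nu (b : box nu) : row b < size nu.
Proof. exact: (ltn_ord (tag b)). Qed.

Lemma col_lt nu (b : box nu) : col b < nth 0 nu (row b).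
Proof. exact: (ltn_ord (tagged b)). Qed.

Lemma box_col_lt w nu (b : box nu) : all (fun p => p <= w) nu -> col b < w.
Proof.
move/allP=> le_w; apply: leq_trans (col_lt b) (le_w _ _).
by rewrite mem_nth ?row_lt.
Qed.

Lemma box_at nu x c :
  c < nth 0 nu x -> exists b : box nu, row b = x /\ col b = c.
Proof.
move=> hc; have hx : x < size nu.
  by rewrite ltnNge; apply/negP => le_x; rewrite nth_default in hc.
pose width (i : 'I_(size nu)) := 'I_(nth 0 nu i).
by exists (Tagged width (i := Ordinal hx) (Ordinal hc)).
Qed.

Lemma box_inj nu (b1 b2 : box nu) :
  row b1 = row b2 -> col b1 = col b2 -> b1 = b2.
Proof.
case: b1 b2 => [i1 j1] [i2 j2]; rewrite /row /col /= => /val_inj ei.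
by case: i2 / ei j2 => j2 /val_inj ->.
Qed.

Lemma semistandardP k nu (t : filling k nu) :
  reflect ((forall b1 b2, row b1 = row b2 -> col b1 < col b2 -> t b1 <= t b2) /\
           (forall b1 b2, col b1 = col b2 -> row b1 < row b2 -> t b1 < t b2))
          (semistandard t).
Proof.
apply: (iffP forallP) => [h | [hrow hcol] b1].
  by split=> b1 b2 e lt; have /forallP/(_ b2)/andP[] := h b1;
     rewrite e eqxx lt.
apply/forallP => b2; rewrite /entry !ltnS; apply/andP; split.
  by apply/implyP => /andP[/eqP]; apply: hrow.
by apply/implyP => /andP[/eqP]; apply: hcol.
Qed.

Definition occurs k nu (t : filling k nu) (i c : nat) : bool :=
  [exists b, (col b == c) && (t b == i :> nat)].

(** Position [i * w + d] is for the letter [i] and the column [w.-1 - d]. *)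
Definition word w k nu (t : filling k nu) : seq bool :=
  mkseq (fun q => occurs t (q %/ w) (w.-1 - q %% w)) (k * w).

Definition column_ones (w : nat) (u : seq bool) (i c : nat) : nat :=
  ones_before w u (i * w + (w.-1 - c)).

Lemma divn_cell w i d : d < w -> (i * w + d) %/ w = i.
Proof.
by move=> hd; rewrite divnMDl ?divn_small ?addn0 // (leq_trans _ hd).
Qed.

Lemma modn_cell w i d : d < w -> (i * w + d) %% w = d.
Proof. by move=> hd; rewrite modnMDl modn_small. Qed.

Lemma column_onesE w u i c : c < w ->
  column_ones w u i c = \sum_(j < i) nth false u (j * w + (w.-1 - c)).
Proof.
by move=> hc; rewrite /column_ones /ones_before divn_cell ?modn_cell //; lia.
Qed.

Lemma column_ones0 w u c : c < w -> column_ones w u 0 c = 0.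
Proof. by move=> hc; rewrite column_onesE // big_ord0. Qed.

Lemma column_onesS w u i c : c < w ->
  column_ones w u i.+1 c =
  column_ones w u i c + nth false u (i * w + (w.-1 - c)).
Proof. by move=> hc; rewrite !column_onesE // big_ord_recr. Qed.

Lemma leq_column_ones w u i j c : c < w -> i <= j ->
  column_ones w u i c <= column_ones w u j c.
Proof.
move=> hc /subnK <-; elim: (j - i) => // m IH.
by rewrite addSn column_onesS // (leq_trans IH) ?leq_addr.
Qed.

Lemma interlaced_columns w k u : size u = k * w ->
  reflect (forall i c, i <= k -> c.+1 < w ->
             column_ones w u i c.+1 <= column_ones w u i c)
          (interlaced w u).
Proof.
move=> sz; apply: (iffP (interlacedP w u)) => [h i c le_ik lt_cw | h q].
  have -> : column_ones w u i c = ones_before w u (i * w + (w.-1 - c.+1)).+1.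
    by congr ones_before; lia.
  apply: h; first by rewrite sz; nia.
  have -> : (i * w + (w.-1 - c.+1)).+1 = i * w + (w.-1 - c) by lia.
  by rewrite /dvdn modn_cell; lia.
rewrite sz => lt_q nd; have w0 : 0 < w by lia.
have lt_r : (q %% w).+1 < w.
  rewrite ltn_neqAle ltn_pmod // andbT; apply: contra nd => /eqP e.
  by rewrite (divn_eq q w) -addnS e dvdn_addl ?dvdn_mull.
have lt_d : q %/ w < k.+1 by rewrite ltn_divLR // mulSn addnC.
have := h (q %/ w) (w.-1 - (q %% w).+1) lt_d.
have -> : (w.-1 - (q %% w).+1).+1 = w.-1 - q %% w by lia.
rewrite /column_ones; have -> : w.-1 - (w.-1 - q %% w) = q %% w by lia.
have -> : w.-1 - (w.-1 - (q %% w).+1) = (q %% w).+1 by lia.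
by rewrite addnS -divn_eq; apply; lia.
Qed.

(** The entries of a column from top to bottom; the default [k] is never
    reached, as there is a box in each row above the height. *)
Definition column k nu (t : filling k nu) (c : nat) : seq nat :=
  mkseq (fun x => oapp (fun b => t b : nat) k
                       [pick b | (row b == x) && (col b == c)])
        (column_height nu c).

Lemma nth_column k nu (t : filling k nu) (b : box nu) : sorted geq nu ->
  nth 0 (column t (col b)) (row b) = t b.
Proof.
move=> sorted_nu; rewrite nth_mkseq -?column_height_row ?col_lt //.
case: pickP => [b' /andP[/eqP er /eqP ec] | /(_ b)]; last by rewrite !eqxx.
by rewrite (box_inj er ec).
Qed.

Lemma column_boxP nu x c : sorted geq nu -> x < column_height nu c ->
  exists b : box nu, row b = x /\ col b = c.
Proof. by move=> sorted_nu; rewrite -column_height_row //; apply: box_at. Qed.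

Lemma mem_column k nu (t : filling k nu) i c : sorted geq nu ->
  (i \in column t c) = occurs t i c.
Proof.
move=> sorted_nu; apply/(nthP 0)/existsP => [[x] | [b /andP[/eqP <- /eqP <-]]].
  rewrite size_mkseq => /(column_boxP sorted_nu) [b [<- <-]].
  by rewrite nth_column // => <-; exists b; rewrite !eqxx.
by exists (row b); rewrite ?nth_column // size_mkseq -column_height_row ?col_lt.
Qed.

Lemma column_sorted k nu (t : filling k nu) c : sorted geq nu ->
  semistandard t -> sorted ltn (column t c).
Proof.
move=> sorted_nu /semistandardP[_ hcol]; apply/(sortedP 0) => x.
rewrite size_mkseq => lt_x.
have [b [rb cb]] := column_boxP sorted_nu lt_x.
have [b' [rb' cb']] := column_boxP sorted_nu (ltnW lt_x).
have -> : nth 0 (column t c) x = t b' by rewrite -rb' -cb' nth_column.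
have -> : nth 0 (column t c) x.+1 = t b by rewrite -rb -cb nth_column.
by apply: hcol; rewrite ?cb ?cb' ?rb ?rb'.
Qed.

Lemma nth_word w k nu (t : filling k nu) i c : i < k -> c < w ->
  nth false (word w t) (i * w + (w.-1 - c)) = occurs t i c.
Proof.
move=> lt_ik lt_cw; have lt_d : w.-1 - c < w by lia.
by rewrite nth_mkseq ?divn_cell ?modn_cell ?subKn //; nia.
Qed.

Lemma column_ones_word w k nu (t : filling k nu) i c :
    sorted geq nu -> semistandard t -> i <= k -> c < w ->
  column_ones w (word w t) i c = count (fun y => y < i) (column t c).
Proof.
move=> sorted_nu ss le_ik lt_cw; rewrite -sum_mem_count; last first.
  exact: sorted_uniq ltn_trans ltnn _ (column_sorted c sorted_nu ss).
rewrite column_onesE //; apply: eq_bigr => j _.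
by rewrite nth_word ?mem_column // (leq_trans (ltn_ord j)).
Qed.

(** The entries below [i] fill the top of a column, so their number decides
    whether a given row is among them. *)
Lemma entry_lt_column_ones w k nu (t : filling k nu) (b : box nu) i :
    sorted geq nu -> semistandard t -> i <= k -> col b < w ->
  (t b < i) = (row b < column_ones w (word w t) i (col b)).
Proof.
move=> sorted_nu ss le_ik lt_bw.
rewrite column_ones_word // -(nth_column t b sorted_nu).
apply: (@count_prefix _ (fun y => y < i)).
  apply: sub_sorted (column_sorted _ sorted_nu ss) => x y /= lt_xy.
  by apply/implyP; apply: ltn_trans.
by rewrite size_mkseq -column_height_row ?col_lt.
Qed.

(** The entries of a tableau are determined by their comparisons with all the
    letters, which are visible in the word. *)
Lemma word_inj w k nu (t t' : filling k nu) :
    sorted geq nu -> all (fun p => p <= w) nu ->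
    semistandard t -> semistandard t' ->
  word w t = word w t' -> t = t'.
Proof.
move=> sorted_nu le_w ss ss' eq_word; apply/ffunP => b; apply: val_inj => /=.
have lt_bw := box_col_lt b le_w.
have key i : i <= k -> (t b < i) = (t' b < i).
  by move=> le_ik; rewrite !(@entry_lt_column_ones w) ?eq_word.
apply/eqP; rewrite eqn_leq -ltnS key ?ltn_ord // ltnSn /=.
by rewrite -ltnS -key ?ltn_ord.
Qed.

Lemma column_totalsP w k nu u : size u = k * w ->
  reflect (forall c, c < w -> column_ones w u k c = column_height nu c)
          (column_totals w 0 (column_height nu) u).
Proof.
move=> sz; apply: (iffP allP) => [h c lt_cw | h d].
  have := h (w.-1 - c); rewrite mem_iota sz addn0 subKn; last by lia.
  by move=> /(_ _)/eqP; apply; lia.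
rewrite mem_iota addn0 => lt_dw; rewrite -h; last by lia.
by rewrite /column_ones sz subKn //; lia.
Qed.

(** If column [c.+1] has more than [y] entries below [i], then its entry in row
    [y] is below [i], and so is the left neighbour of that entry. *)
Lemma word_conditions w k nu (t : filling k nu) :
    sorted geq nu -> all (fun p => p <= w) nu -> semistandard t ->
  interlaced w (word w t) && column_totals w 0 (column_height nu) (word w t).
Proof.
move=> sorted_nu le_w ss.
have sz : size (word w t) = k * w by rewrite size_mkseq.
apply/andP; split; last first.
  apply/(column_totalsP _ sz) => c lt_cw; rewrite column_ones_word //.
  have <- : size (column t c) = column_height nu c by rewrite size_mkseq.
  apply/eqP; rewrite -all_count.
  apply/allP => y; rewrite mem_column // => /existsP[b /andP[_ /eqP <-]].
  exact: ltn_ord.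
apply/(interlaced_columns sz) => i c le_ik lt_cw.
case e : (column_ones w (word w t) i c.+1) => [//|y].
have lt_y : y < column_height nu c.+1.
  rewrite -e column_ones_word //; apply: leq_trans (count_size _ _) _.
  by rewrite size_mkseq.
have [b [rb cb]] := column_boxP sorted_nu lt_y.
have [b' [rb' cb']] : exists b' : box nu, row b' = y /\ col b' = c.
  by apply: box_at; apply: ltnW; rewrite column_height_row.
have /semistandardP[hrow _] := ss.
have lt_b : t b < i by rewrite (@entry_lt_column_ones w) // cb ?e ?rb.
have : t b' < i.
  by apply: leq_ltn_trans lt_b; apply: hrow; rewrite ?rb ?cb ?rb' ?cb'.
by rewrite (@entry_lt_column_ones w) // cb' ?rb' // ltnW.
Qed.

(** The box in row [x] of column [c] receives the first letter [i] such that
    the column has more than [x] ones up to [i]. *)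
Lemma word_surj w k nu u :
    sorted geq nu -> all (fun p => p <= w) nu -> size nu = k ->
    size u = k * w ->
    interlaced w u -> column_totals w 0 (column_height nu) u ->
  exists2 t : filling k nu, semistandard t & word w t = u.
Proof.
move=> sorted_nu le_w sz_nu sz_u /(interlaced_columns sz_u) mono_c.
move=> /(column_totalsP nu sz_u) total.
have lt_bw (b : box nu) := box_col_lt b le_w.
pose reached (b : box nu) i := row b < column_ones w u i.+1 (col b).
have lt_k b : find (reached b) (iota 0 k) < k.
  rewrite -[X in _ < X](size_iota 0 k) -has_find; apply/hasP.
  have k0 : 0 < k by rewrite -sz_nu (leq_trans _ (row_lt b)).
  exists k.-1; first by rewrite mem_iota; lia.
  by rewrite /reached prednK // total // -column_height_row ?col_lt.
pose t : filling k nu := [ffun b => Ordinal (lt_k b)].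
have ltE b i : i <= k -> (t b < i) = (row b < column_ones w u i (col b)).
  move=> le_ik; rewrite ffunE /=; set m := find _ _.
  have lt_mk : m < k := lt_k b.
  have [lt_mi | le_im] := ltnP m i.
    apply/esym; apply: leq_trans (leq_column_ones u (lt_bw b) lt_mi).
    have := lt_k b; rewrite -[X in _ < X](size_iota 0 k) -has_find.
    by move/(nth_find 0); rewrite -/m nth_iota.
  apply/esym/negbTE; case: i le_ik le_im => [|i] le_ik le_im.
    by rewrite column_ones0.
  by have := before_find 0 le_im; rewrite nth_iota // => /negbT.
exists t.
  apply/semistandardP; split=> b1 b2 e lt.
    rewrite -ltnS ltE // e.
    have : row b2 < column_ones w u (t b2).+1 (col b2) by rewrite -ltE.
    move/leq_trans; apply.
    elim: (col b2) (lt_bw b2) lt => // c IH lt_cw.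
    rewrite ltnS leq_eqVlt => /predU1P[-> | lt]; first exact: mono_c.
    by apply: leq_trans (mono_c _ _ _ lt_cw) (IH _ lt); rewrite // ltnW.
  rewrite ltE ?e; last exact: ltnW.
  apply: leq_trans lt _; have : t b2 < (t b2).+1 by [].
  rewrite ltE // column_onesS //.
  move/leq_trans/(_ (leq_add (leqnn _) (leq_b1 _))).
  by rewrite addn1.
apply: (@eq_from_nth _ false); rewrite size_mkseq // => q lt_q.
have w0 : 0 < w by case: (w) lt_q => //; rewrite muln0.
have lt_r := ltn_pmod q w0; set c := w.-1 - q %% w; set i := q %/ w.
have lt_ik : i < k by rewrite /i ltn_divLR.
have lt_cw : c < w by rewrite /c; lia.
have eq_q : q = i * w + (w.-1 - c).
  by rewrite /c subKn ?[LHS](divn_eq q w) //; lia.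
rewrite eq_q nth_word //; have := column_onesS u i lt_cw.
have : column_ones w u i.+1 c <= column_height nu c.
  by rewrite -total // leq_column_ones.
set y := column_ones w u i c => le_h; case: nth => /= e.
  have [|b [rb cb]] := @column_boxP nu y c sorted_nu; first by lia.
  apply/existsP; exists b; rewrite cb eqxx /= eqn_leq.
  rewrite -ltnS ltE // cb rb e addn1 ltnSn /=.
  by rewrite leqNgt ltE ?cb ?rb ?ltnn // ltnW.
apply/negbTE/existsP => -[b /andP[/eqP cb /eqP tb]].
have := ltE b i.+1 lt_ik; have := ltE b i (ltnW lt_ik).
by rewrite tb cb ltnn ltnSn e addn0 => <-.
Qed.

Lemma card_SSYT_words w k nu (Q : pred (seq bool)) :
    sorted geq nu -> all (fun p => p <= w) nu -> size nu = k ->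
  #|[set t in SSYT k nu | Q (word w t)]| =
  words (k * w) (fun u => [&& interlaced w u,
                              column_totals w 0 (column_height nu) u & Q u]).
Proof.
move=> sorted_nu le_w sz_nu; rewrite /words.
pose F (t : filling k nu) : (k * w).-tuple bool := [tuple of word w t].
rewrite -(card_in_imset (f := F)) => [|t t']; last first.
  rewrite !inE => /andP[ss _] /andP[ss' _] /(congr1 val) /=.
  exact: word_inj.
apply: eq_card => u; rewrite inE; apply/imsetP/and3P => [[t + ->] | [hi hh hQ]].
  rewrite !inE => /andP[ss Qt].
  by have /andP[] := word_conditions sorted_nu le_w ss.
have [t ss eq_u] := word_surj sorted_nu le_w sz_nu (size_tuple u) hi hh.
by exists t; [rewrite !inE ss eq_u | apply: val_inj].
Qed.

(** * Strips as runs of ones *)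

Lemma count_ones_columns w k u : size u = k * w ->
  count id u = \sum_(c < w) column_ones w u k c.
Proof.
move=> sz; have -> : count id u = \sum_(q < k * w) nth false u q.
  have -> : count id u = \sum_(b <- u) b.
    by elim: u {sz} => [|b u IH]; rewrite ?big_nil ?big_cons //= IH.
  by rewrite (big_nth false) big_mkord sz.
have -> : \sum_(q < k * w) nth false u q =
          \sum_(j < k) \sum_(d < w) nth false u (j * w + d).
  elim: k {sz} => [|k IH]; first by rewrite !big_ord0.
  by rewrite mulSnr big_split_ord big_ord_recr /= -IH.
rewrite (eq_bigr (fun c : 'I_w =>
                    \sum_(j < k) nth false u (j * w + (w.-1 - c)) : nat)).
  rewrite [RHS]exchange_big /=; apply: eq_bigr => j _.
  rewrite (reindex_inj rev_ord_inj) /=; apply: eq_bigr => c _.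
  have -> // : w - c.+1 = w.-1 - c by lia.
by move=> c _; rewrite column_onesE.
Qed.

Lemma sum_column_height w nu : all (fun p => p <= w) nu ->
  \sum_(c < w) column_height nu c = sumn nu.
Proof.
rewrite /column_height; elim: nu => /= [|p nu IH].
  by move=> _; rewrite big1.
case/andP=> le_pw /IH <-; rewrite big_split /=; congr (_ + _).
have -> : \sum_(c < w) (c < p) = \sum_(c < p) 1.
  rewrite (big_ord_widen w (fun _ => 1) le_pw) [RHS]big_mkcond /=.
  by apply: eq_bigr => c _; case: ltnP.
by rewrite sum1_card card_ord.
Qed.

Lemma count_zeros w k nu u : size u = k * w -> all (fun p => p <= w) nu ->
  column_totals w 0 (column_height nu) u -> count negb u = k * w - sumn nu.
Proof.
move=> sz le_w /(column_totalsP nu sz) total.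
rewrite -sz -(count_predC id) (count_ones_columns sz) -(sum_column_height le_w).
rewrite (eq_bigr _ (fun c : 'I_w => fun _ => total c (ltn_ord c))) addKn.
exact: eq_count.
Qed.

(** Forgets the rows of a strip: only which of the letters [i] and [i.+1] each
    column contributes. *)
Definition covers w k nu (t : filling k nu) (i a : nat) : Prop :=
  (forall c, c < a -> occurs t i c) /\
  (forall c, a <= c < w -> occurs t i.+1 c).

(** A block that starts in the letter [i] ends in [i.+1], except when it is
    exactly the part of the last letter [k.-1]; it is then covered with [a = 0]
    and [i = k.-2].  This needs [1 < k], and the zero excludes the case [k = 1],
    in which the block would be the whole word. *)
Lemma covers_of_run w k nu (t : filling k nu) : 0 < count negb (word w t) ->
  has_run w (word w t) -> exists i a, [/\ i.+1 < k, a <= w & covers w t i a].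
Proof.
move=> zeros [s hs]; have sz : size (word w t) = k * w by rewrite size_mkseq.
have w0 : 0 < w.
  move: zeros; have := count_size negb (word w t).
  by rewrite sz; case: (w); lia.
have le_s : s + w <= k * w.
  rewrite -sz leqNgt; apply/negP => lt_sz; have := hs w.-1.
  by rewrite nth_default; [rewrite ltn_predL w0 => /(_ isT) | lia].
have lt_e := ltn_pmod s w0; have def_s := divn_eq s w.
move: (s %/ w) (s %% w) lt_e def_s => i e lt_e def_s.
have lt_ik : i < k by nia.
have [lt_ik1 | ge_ik1] := ltnP i.+1 k.
  exists i, (w - e); split=> //; first by lia.
  split=> c hc; rewrite -(@nth_word w) //; try lia.
    have -> : i * w + (w.-1 - c) = s + (w.-1 - c - e) by lia.
    by apply: hs; lia.
  have -> : i.+1 * w + (w.-1 - c) = s + (w - e + (w.-1 - c)).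
    by rewrite mulSn; lia.
  by apply: hs; lia.
have def_k : k = i.+1 by lia.
have e0 : e = 0 by nia.
case: i def_s lt_ik ge_ik1 def_k => [|i] def_s _ _ def_k.
  move: zeros; rewrite -has_count => /hasP[b /(nthP false)[q]].
  rewrite sz => lt_q <-; have lt_qw : q < w by rewrite -(mul1n w) -def_k.
  have := hs q lt_qw.
  by rewrite def_s e0 => ->.
exists i, 0; split; [by lia | by [] | split=> // c hc].
rewrite -(@nth_word w) //; try lia.
have -> : i.+1 * w + (w.-1 - c) = s + (w.-1 - c) by rewrite def_s e0; lia.
by apply: hs; lia.
Qed.

Lemma run_of_covers w k nu (t : filling k nu) i a :
  i.+1 < k -> a <= w -> covers w t i a -> has_run w (word w t).
Proof.
move=> lt_ik le_aw [hi hi1]; exists (i * w + (w - a)) => p lt_pw.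
have [lt_pa | le_ap] := ltnP p a.
  have -> : i * w + (w - a) + p = i * w + (w.-1 - (a.-1 - p)) by lia.
  by rewrite nth_word ?hi //; lia.
have -> : i * w + (w - a) + p = i.+1 * w + (w.-1 - (w.-1 - (p - a))).
  by rewrite mulSn; lia.
by rewrite nth_word ?hi1 //; lia.
Qed.

(** Extending the part with letter [i] moves the block to the start of its run,
    which is what makes the chosen boxes a strip. *)
Lemma maximal_covers w k nu (t : filling k nu) i a : a <= w -> covers w t i a ->
  exists a', [/\ a' <= w, covers w t i a' & a' < w -> ~~ occurs t i a'].
Proof.
have [m] := ubnP (w - a); elim: m a => // m IH a lt_m le_aw cov.
have [lt_aw | le_wa] := ltnP a w; last by exists a; split=> //; lia.
case: (boolP (occurs t i a)) => [occ | nocc]; last by exists a.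
apply: (IH a.+1) => //; first by lia.
case: cov => hi hi1; split=> c hc; last by apply: hi1; lia.
by move: hc; rewrite ltnS leq_eqVlt => /predU1P[-> | /hi].
Qed.

Lemma card_transversal w nu (S : {set box nu}) : all (fun p => p <= w) nu ->
    {in S &, injective (@col nu)} ->
  #|S| = w <-> forall c, c < w -> exists2 b, b \in S & col b = c.
Proof.
move=> le_w injS; pose F (b : box nu) : 'I_w := Ordinal (box_col_lt b le_w).
have cardF : #|F @: S| = #|S|.
  by apply: card_in_imset => b1 b2 h1 h2 /(congr1 val); apply: injS.
split=> [card_S c lt_cw | onto].
  have fullF : F @: S = [set: 'I_w].
    by apply/eqP; rewrite eqEcard subsetT cardsT card_ord cardF card_S leqnn.
  have : Ordinal lt_cw \in F @: S by rewrite fullF inE.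
  by case/imsetP => b bS /(congr1 val) /= ->; exists b.
rewrite -cardF -[RHS]card_ord -cardsT; congr #|pred_of_set _|.
apply/setP => c; rewrite inE; have [b bS e] := onto c (ltn_ord c).
by apply/imsetP; exists b => //; apply: val_inj.
Qed.

Lemma strip_covers w k nu (t : filling k nu) i (S : {set box nu}) :
    all (fun p => p <= w) nu -> ii1_strip w t i.+1 S ->
  exists2 a, a <= w & covers w t i a.
Proof.
move=> le_w /and3P[/and3P[/eqP card_S /forall_inP inj_S _]].
move=> /forall_inP lett /forall_inP ord.
have injS : {in S &, injective (@col nu)}.
  move=> b1 b2 h1 h2 e; apply/eqP; apply: contraTT (eqxx (col b1)) => ne.
  by have /forall_inP/(_ b2 h2)/implyP/(_ ne) := inj_S b1 h1; rewrite e.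
have [/(_ card_S) onto _] := card_transversal le_w injS.
pose hi c := [exists b in S, (col b == c) && (t b == i.+1 :> nat)].
exists (find hi (iota 0 w)).
  by rewrite -[X in _ <= X](size_iota 0 w) find_size.
have letter b : b \in S -> (t b = i :> nat) \/ (t b = i.+1 :> nat).
  by move/lett; rewrite /entry !eqSS => /orP[/eqP|/eqP]; [left|right].
split=> c hc.
  have lt_cw : c < w.
    by apply: leq_trans hc _; rewrite -[X in _ <= X](size_iota 0 w) find_size.
  have [b bS cb] := onto c lt_cw; apply/existsP; exists b; rewrite cb eqxx /=.
  case: (letter b bS) => [-> // | tb].
  have := before_find 0 hc; rewrite nth_iota // add0n => /negbT/exists_inP[].
  by exists b; rewrite ?cb ?tb ?eqxx.
case/andP: hc => le_c lt_cw; have [b bS cb] := onto c lt_cw.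
apply/existsP; exists b; rewrite cb eqxx /=.
case: (letter b bS) => [tb | -> //]; set a := find _ _ in le_c.
have lt_aw : a < w by apply: leq_ltn_trans lt_cw.
have : hi a.
  have : has hi (iota 0 w) by rewrite has_find size_iota.
  by move/(nth_find 0); rewrite -/a nth_iota.
case/exists_inP => b' b'S /andP[/eqP cb' /eqP tb'].
have /forall_inP/(_ b' b'S)/implyP := ord b bS.
by rewrite /entry tb tb' !eqxx cb cb' ltnNge le_c => /(_ isT).
Qed.

(** Columns are strict, so the box of a column with a given letter is unique,
    and two boxes with the same letter never descend from left to right.
    Suppose that a letter [i] lies above a letter [i.+1] on its right.  By
    maximality column [a], between them, has no [i]; its entry in the upper row
    is then at least [i.+1], and its entry in the lower row at least [i.+2],
    which is too large to stand left of [i.+1]. *)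
Lemma covers_strip w k nu (t : filling k nu) i a :
    sorted geq nu -> all (fun p => p <= w) nu -> semistandard t ->
    a <= w -> covers w t i a -> (a < w -> ~~ occurs t i a) ->
  exists S : {set box nu}, ii1_strip w t i.+1 S.
Proof.
move=> sorted_nu le_w ss le_aw [occ_i occ_i1] maxa.
have /semistandardP[hrow hcol] := ss.
pose S := [set b : box nu |
  if col b < a then t b == i :> nat else t b == i.+1 :> nat].
have same_box (b1 b2 : box nu) :
    t b1 = t b2 :> nat -> col b1 = col b2 -> b1 = b2.
  move=> et ec; apply: box_inj => //.
  by case: (ltngtP (row b1) (row b2)) => // lt;
     [have := hcol b1 b2 ec lt | have := hcol b2 b1 (esym ec) lt];
     rewrite et ltnn.
have injS : {in S &, injective (@col nu)}.
  move=> b1 b2; rewrite !inE => h1 h2 ec; apply: same_box => //.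
  by move: h1 h2; rewrite ec; case: ifP => _ /eqP -> /eqP ->.
exists S; apply/and3P; split; first (apply/and3P; split).
- apply/eqP/(card_transversal le_w injS) => c lt_cw.
  have [lt_ca | le_ac] := ltnP c a.
    have /existsP[b /andP[/eqP cb tb]] := occ_i c lt_ca.
    by exists b; rewrite // inE cb lt_ca.
  have [|b /andP[/eqP cb tb]] := existsP (occ_i1 c _); first by rewrite le_ac.
  by exists b; rewrite // inE cb ltnNge le_ac.
- apply/forall_inP => b1 h1; apply/forall_inP => b2 h2; apply/implyP.
  by apply: contra => /eqP/injS->.
- apply/forall_inP => b1 h1; apply/forall_inP => b2 h2; apply/implyP => lt_c.
  apply/negP => lt_r.
  have corner c : c <= col b2 -> exists b : box nu, row b = row b2 /\ col b = c.
    by move=> le_c; apply: box_at; apply: leq_ltn_trans (col_lt b2).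
  have upper c : c <= col b2 -> exists b : box nu, row b = row b1 /\ col b = c.
    move=> le_c; apply: box_at; rewrite column_height_row //.
    apply: ltn_trans lt_r _.
    by rewrite -column_height_row //; apply: leq_ltn_trans (col_lt b2).
  have weak (x y : box nu) : row x = row y -> col x <= col y -> t x <= t y.
    move=> er; rewrite leq_eqVlt => /predU1P[ec | ]; last exact: hrow.
    by rewrite (box_inj er ec).
  have [x [rx cx]] := corner (col b1) (ltnW lt_c).
  have lt_1x : t b1 < t x by apply: hcol; rewrite ?cx ?rx.
  have le_x2 : t x <= t b2 by apply: weak; rewrite ?rx ?cx // ltnW.
  move: h1 h2; rewrite !inE; case: ltnP => c1; case: ltnP => c2 /eqP t1 /eqP t2;
    try lia.
  (* [y] and [z] are the boxes of column [a] in the rows of [b1] and [b2]. *)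
  have [y [ry cy]] := upper a c2.
  have [z [rz cz]] := corner a c2.
  have lt_aw : a < w by apply: leq_ltn_trans (box_col_lt b2 le_w).
  have ne_y : t y != i :> nat.
    apply: contra (maxa lt_aw) => ty; apply/existsP; exists y.
    by rewrite cy eqxx.
  have le_1y : t b1 <= t y by apply: weak; rewrite ?ry ?cy // ltnW.
  have lt_yz : t y < t z by apply: hcol; rewrite ?cy ?cz ?ry ?rz.
  have le_z2 : t z <= t b2 by apply: weak; rewrite ?rz ?cz.
  by move/eqP: ne_y; lia.
- apply/forall_inP => b; rewrite inE /entry !eqSS.
  by case: ifP => _ ->; rewrite ?orbT.
- apply/forall_inP => b1 h1; apply/forall_inP => b2 h2; apply/implyP.
  rewrite /entry !eqSS => /andP[/eqP t1 /eqP t2].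
  move: h1 h2; rewrite !inE t1 t2; case: ltnP => c1; case: ltnP => c2 //;
    lia.
Qed.

Lemma one_strip_less_word w k nu (t : filling k nu) :
    sorted geq nu -> all (fun p => p <= w) nu -> semistandard t ->
    0 < w -> 0 < count negb (word w t) ->
  one_strip_less w t = short_runs w (count negb (word w t)).+1 (word w t).
Proof.
move=> sorted_nu le_w ss w0 zeros.
apply/idP/idP => [no_strip | /(short_runs_no_run _ w0)].
  apply/(short_runs_no_run _ w0) => /(covers_of_run zeros).
  case=> i [a [lt_ik le_aw cov]].
  have [a' [le_aw' cov' maxa]] := maximal_covers le_aw cov.
  have [S hS] := covers_strip sorted_nu le_w ss le_aw' cov' maxa.
  by case/existsP: no_strip; exists S; apply/existsP; exists (Ordinal lt_ik).
move=> no_run; apply/existsP => -[S /existsP[[[|i] lt_ik] //= hS]].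
apply: no_run.
have [a le_aw cov] := strip_covers le_w hS.
exact: run_of_covers cov.
Qed.

(** * The alternating sum *)

Lemma remove_partsE (w j : nat) (mu : seq nat) : j <= count_mem w mu ->
  perm_eq mu (nseq j w ++ remove_parts w j mu).
Proof.
elim: j => [|j IH] le_j //; have p := IH (ltnW le_j).
have w_in : w \in remove_parts w j mu.
  rewrite -has_pred1 has_count.
  move/permP/(_ (pred1 w)): p; rewrite count_cat count_nseq /= eqxx mul1n => e.
  by rewrite -(ltn_add2l j) addn0 -e.
apply: perm_trans p _; set nu := remove_parts w j mu in w_in *.
apply: (@perm_trans _ (nseq j w ++ [:: w] ++ rem w nu)).
  by rewrite perm_cat2l perm_to_rem.
by rewrite perm_catCA.
Qed.

Lemma remove_parts_sorted (w j : nat) (mu : seq nat) :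
  sorted geq mu -> sorted geq (remove_parts w j mu).
Proof.
move=> sorted_mu; elim: j => //= j; apply: subseq_sorted (rem_subseq _ _).
by move=> y x z /= le_yx le_zy; apply: leq_trans le_zy le_yx.
Qed.

Lemma column_height_last (w : nat) (mu : seq nat) :
    0 < w -> all (fun p => p <= w) mu ->
  column_height mu w.-1 = count_mem w mu.
Proof. by move=> w0 /allP le_w; apply: eq_in_count => p /le_w /=; lia. Qed.

(** The [n - 1] zeros follow from the shape and the number of letters:
    [(r - j) w - (|mu| - j w) = r w - (r - 1) (w - 1) = n - 1]. *)
Lemma card_SSYT_admissible (r n : nat) (mu : seq nat) (j : nat) :
    1 <= r -> r < n -> partition_in_rect r (n - r) mu ->
    sumn mu = (r - 1) * (n - r - 1) -> j <= count_mem (n - r) mu ->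
  #|SSYT (r - j) (remove_parts (n - r) j mu)| =
  words ((r - j) * (n - r))
    (admissible (n - r) j (column_height mu) (n - 1) 0).
Proof.
move=> hr hrn hmu hsize.
set w := n - r => le_jm; have w0 : 0 < w by rewrite subn_gt0.
case/and3P: hmu => /eqP sz_mu sorted_mu le_w.
have perm_mu := remove_partsE le_jm; set nu := remove_parts w j mu in perm_mu *.
have sz_nu : size nu = r - j.
  have := perm_size perm_mu; rewrite size_cat size_nseq sz_mu => e.
  by rewrite [in RHS]e addKn.
have le_w' : all (fun p => p <= w) nu.
  by move: le_w; rewrite (perm_all _ perm_mu) all_cat => /andP[].
have sum_nu : sumn nu = (r - 1) * (w - 1) - j * w.
  by rewrite -hsize (perm_sumn perm_mu) sumn_cat sumn_nseq mulnC addKn.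
have le_jr : j <= r.
  by rewrite -sz_mu (leq_trans le_jm) ?count_size.
have height c : c < w -> column_height mu c = column_height nu c + j.
  move=> lt_cw; rewrite /column_height; have /permP -> := perm_mu.
  by rewrite count_cat count_nseq lt_cw mul1n addnC.
have -> : SSYT (r - j) nu = [set t in SSYT (r - j) nu | xpredT (word w t)].
  by apply/setP => t; rewrite !inE andbT.
rewrite (@card_SSYT_words w _ _ xpredT) ?remove_parts_sorted //.
apply: eq_words => u sz_u; rewrite /admissible !andbT; congr (_ && _).
have -> : column_totals w j (column_height mu) u =
          column_totals w 0 (column_height nu) u.
  apply: eq_in_all => d; rewrite mem_iota => lt_d.
  by rewrite addn0 height ?eqn_add2r //; lia.
case: (boolP (column_totals w 0 (column_height nu) u)) => // match_u.
have := count_zeros sz_u le_w' match_u; rewrite sum_nu => ->.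
apply/esym/eqP.
have : sumn mu = j * w + sumn nu.
  by rewrite (perm_sumn perm_mu) sumn_cat sumn_nseq mulnC.
rewrite hsize -/w sum_nu /w; nia.
Qed.

(** The [n] runs are all the runs of a word with [n - 1] zeros. *)
Lemma card_one_strip_less (r n : nat) (mu : seq nat) :
    1 <= r -> r < n -> partition_in_rect r (n - r) mu ->
    sumn mu = (r - 1) * (n - r - 1) ->
  #|[set t in SSYT r mu | one_strip_less (n - r) t]| =
  words (r * (n - r)) (admissible (n - r) 0 (column_height mu) (n - 1) n).
Proof.
move=> hr hrn hmu hsize.
set w := n - r; have w0 : 0 < w by rewrite subn_gt0.
case/and3P: hmu => /eqP sz_mu sorted_mu le_w.
have zeros u : size u = r * w -> column_totals w 0 (column_height mu) u ->
    count negb u = n - 1.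
  by move=> sz /(count_zeros sz le_w) ->; rewrite hsize -/w /w; nia.
have -> : [set t in SSYT r mu | one_strip_less w t] =
          [set t in SSYT r mu | short_runs w n (word w t)].
  apply/setP => t; rewrite !inE; case: (boolP (semistandard t)) => //= ss.
  have /andP[_ match_t] := word_conditions sorted_mu le_w ss.
  have zt := zeros _ (size_mkseq _ _) match_t.
  rewrite one_strip_less_word ?zt //; last by lia.
  by congr short_runs; lia.
rewrite (@card_SSYT_words w _ _ (short_runs w n)) //.
apply: eq_words => u sz_u; rewrite /admissible; congr (_ && _).
case: (boolP (column_totals w 0 (column_height mu) u)) => //=.
by move/(zeros _ sz_u) ->; rewrite eqxx.
Qed.

Theorem theorem4 (r n : nat) (mu : seq nat) (hr : (1 <= r)%N) (hrn : (r < n)%N)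
    (hmu : partition_in_rect r (n - r) mu)
    (hsize : sumn mu = ((r - 1) * (n - r - 1))%N) :
  Gamma r n mu = Posz #|[set t in SSYT r mu | one_strip_less (n - r) t]|.
Proof.
rewrite card_one_strip_less //; have /and3P[/eqP sz_mu sorted_mu le_w] := hmu.
pose f g j := words ((r - j) * (n - r))
                    (admissible (n - r) j (column_height mu) (n - 1) g).
have w0 : 0 < n - r by rewrite subn_gt0.
have unroll : forall g j, g < n -> f g j = f g.+1 j + f g j.+1.
  by move=> g j lt_gn; apply: words_admissibleS => //; lia.
have := binomial_unroll unroll 0; rewrite /f subn0 => ->.
set m := count_mem (n - r) mu.
have le_mn : m < n.+1.
  by rewrite ltnS (leq_trans (count_size _ _)) // sz_mu ltnW.
pose F j : int :=
  ((-1) ^+ j * 'C(n, j)%:Z *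
   #|SSYT (r - j)%N (remove_parts (n - r)%N j mu)|%:Z)%R.
have -> : Gamma r n mu = (\sum_(j < m.+1) F j)%R by rewrite /Gamma big_mkord.
rewrite (big_ord_widen n.+1 F le_mn) big_mkcond; apply: eq_bigr => j _.
rewrite add0n /F ltnS; case: leqP => [le_jm | lt_mj].
  by rewrite card_SSYT_admissible.
(* The last column of [mu] has height [m], so it cannot lose [j > m] boxes. *)
rewrite words_eq0 ?mulr0 // => u sz_u; apply/negP => /and4P[_ /allP height _ _].
have := height 0; rewrite mem_iota subn0 column_height_last // -/m.
move=> /(_ w0)/eqP.
lia.
Qed.
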